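(* Let $\mu$ be a pre-permuton and let $(\sigma_n)_{n\in\mathbb{N}^*}$ be random permutations such that for each $n\in\mathbb{N}^*$, $\sigma_n\sim\mathrm{Sample}_n(\mu)$. Then for any $k\in\mathbb{N}^*$, the following convergences hold almost surely: $$\frac1n \mathrm{LIS}_k(\sigma_n)\xrightarrow[n\to\infty]{}\widetilde{\mathrm{LIS}}_k(\mu),\qquad \frac1n \mathrm{LDS}_k(\sigma_n)\xrightarrow[n\to\infty]{}\widetilde{\mathrm{LDS}}_k(\mu).$$
   Context: $\mathbb{N}^*=\{1,2,\dots\}$. A pre-permuton is a Borel probability measure on $[0,1]^2$ whose two marginals have no atoms. Given points $Z_1,\dots,Z_n\in[0,1]^2$ with distinct $x$-coordinates and distinct $y$-coordinates, $\mathrm{Perm}(Z_1,\dots,Z_n)$ is the permutation $\sigma$ of $\{1,\dots,n\}$ with $\sigma(i)=j$ whenever the point with $i$-th lowest $x$-coordinate has $j$-th lowest $y$-coordinate. $\mathrm{Sample}_n(\mu)$ is the law of $\mathrm{Perm}(Z_1,\dots,Z_n)$ for $Z_1,\dots,Z_n$ i.i.d. with law $\mu$ (a.s. well defined). The $\sigma_n$ are defined on a common probability space; no assumption is made on their joint distribution. For a permutation $\sigma$ of size $n$, an increasing (resp. decreasing) subsequence is a set of indices $\{i_1<\dots<i_\ell\}$ with $\sigma(i_1)<\dots<\sigma(i_\ell)$ (resp. $>$). $\mathrm{LIS}_k(\sigma):=\max|I_1\cup\dots\cup I_k|$ over families of $k$ (not necessarily disjoint) increasing subsequences; $\mathrm{LDS}_k(\sigma)$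 is defined likewise with decreasing subsequences. A subset $A\subset[0,1]^2$ is nondecreasing (resp. nonincreasing) if for all $(x_1,y_1),(x_2,y_2)\in A$, $(x_2-x_1)(y_2-y_1)\ge 0$ (resp. $\le 0$). It is $k$-nondecreasing (resp. $k$-nonincreasing) if it is a union of $k$ nondecreasing (resp. nonincreasing) subsets. $\widetilde{\mathrm{LIS}}_k(\mu):=\sup_A \mu(A)$ over closed $k$-nondecreasing $A\subset[0,1]^2$, and $\widetilde{\mathrm{LDS}}_k(\mu):=\sup_A\mu(A)$ over closed $k$-nonincreasing $A\subset[0,1]^2$. *)

(* Defs.v *)
From HB Require Import structures.
From mathcomp Require Import all_boot all_order all_algebra all_fingroup.
From mathcomp Require Import all_classical all_reals all_analysis.

Set Implicit Arguments.
Unset Strict Implicit.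
Unset Printing Implicit Defensive.

Import Order.TTheory GRing.Theory Num.Theory.
Import numFieldNormedType.Exports.

Local Open Scope classical_set_scope.
Local Open Scope ring_scope.

(* Permutations of size n are elements of 'S_n, i.e. permutations of the
   0-based index set {0, ..., n-1}. *)

Definition increasing_subseq (n : nat) (s : 'S_n) (I : {set 'I_n}) : bool :=
  [forall i in I, forall j in I, (i < j)%N ==> (s i < s j)%N].

Definition decreasing_subseq (n : nat) (s : 'S_n) (I : {set 'I_n}) : bool :=
  [forall i in I, forall j in I, (i < j)%N ==> (s j < s i)%N].

Definition LIS (k n : nat) (s : 'S_n) : nat :=
  \max_(I : {ffun 'I_k -> {set 'I_n}} | [forall a, increasing_subseq s (I a)])
    #|(\bigcup_(a < k) I a)%SET|.

Definition LDS (k n : nat) (s : 'S_n) : nat :=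
  \max_(I : {ffun 'I_k -> {set 'I_n}} | [forall a, decreasing_subseq s (I a)])
    #|(\bigcup_(a < k) I a)%SET|.

Definition unit_square (R : realType) : set (R * R) := `[0, 1] `*` `[0, 1].
Arguments unit_square : clear implicits.

(* R * R carries the product of the Borel sigma-algebras, which is the Borel
   sigma-algebra of the plane; a measure on the unit square is represented as
   a measure on the plane concentrated on the square. *)
Definition pre_permuton (R : realType) (mu : probability (R * R)%type R) :
    Prop :=
  [/\ mu (unit_square R) = 1%E,
      forall x : R, pushforward mu fst [set x] = 0%E &
      forall y : R, pushforward mu snd [set y] = 0%E].

Definition nondecreasing_subset (R : realType) (A : set (R * R)) : Prop :=
  forall p q : R * R, A p -> A q -> 0 <= (q.1 - p.1) * (q.2 - p.2).

Definition nonincreasing_subset (R : realType) (A : set (R * R)) : Prop :=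
  forall p q : R * R, A p -> A q -> (q.1 - p.1) * (q.2 - p.2) <= 0.

Definition k_nondecreasing (R : realType) (k : nat) (A : set (R * R)) : Prop :=
  exists2 B : 'I_k -> set (R * R),
    (forall a, nondecreasing_subset (B a)) & A = \bigcup_a B a.

Definition k_nonincreasing (R : realType) (k : nat) (A : set (R * R)) : Prop :=
  exists2 B : 'I_k -> set (R * R),
    (forall a, nonincreasing_subset (B a)) & A = \bigcup_a B a.

Definition LIS_tilde (R : realType) (k : nat)
    (mu : probability (R * R)%type R) : \bar R :=
  ereal_sup [set mu A | A in
    [set A | [/\ closed A, A `<=` unit_square R & k_nondecreasing k A]]].

Definition LDS_tilde (R : realType) (k : nat)
    (mu : probability (R * R)%type R) : \bar R :=
  ereal_sup [set mu A | A in
    [set A | [/\ closed A, A `<=` unit_square R & k_nonincreasing k A]]].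

Section iid_law.
Context (d : measure_display) (T : measurableType d) (R : realType).
Variable mu : probability T R.

Definition pair_cons (n : nat) (p : T * n.-tuple T) : n.+1.-tuple T :=
  [tuple of p.1 :: p.2].

Lemma measurable_pair_cons (n : nat) : measurable_fun setT (@pair_cons n).
Proof.
exact: (measurable_cons measurable_fst measurable_snd).
Qed.

HB.instance Definition _ (n : nat) :=
  isMeasurableFun.Build _ _ _ _ (@pair_cons n) (@measurable_pair_cons n).

(* The joint law of n i.i.d. variables of law mu, i.e. the n-fold product
   measure of mu on n.-tuple T; see iid_law_rect for the product rule. *)
Fixpoint iid_law (n : nat) : probability (n.-tuple T) R :=
  if n is m.+1 then distribution (mu \x iid_law m)%E (@pair_cons m)
  else dirac [tuple].

Lemma iid_law_rect (n : nat) (A : 'I_n -> set T) :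
  (forall i, measurable (A i)) ->
  iid_law n [set z | forall i, A i (tnth z i)] = (\prod_(i < n) mu (A i))%E.
Proof.
elim: n A => [|n IHn] A mA /=.
  by rewrite big_ord0 diracE mem_set// => -[].
rewrite big_ord_recl -IHn; last by move=> i; exact: mA.
rewrite /distribution /pushforward.
have -> : @pair_cons n @^-1` [set z | forall i, A i (tnth z i)] =
    A ord0 `*` [set z | forall i, A (lift ord0 i) (tnth z i)].
  apply/seteqP; split=> -[x z] /=.
    move=> Axz; split=> [|i]; first exact: (Axz ord0).
    by have := Axz (lift ord0 i); rewrite /pair_cons tnthS.
  by move=> [Ax Az] i; case: (unliftP ord0 i) => [j|] ->; rewrite /pair_cons ?tnthS //=; exact: Az.
rewrite product_measure1E//.
rewrite (_ : [set _ | _] =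
  \bigcap_(i in [set: 'I_n]) ((@tnth n T)^~ i @^-1` A (lift ord0 i))).
  apply: fin_bigcap_measurable => // i _.
  by rewrite -[X in measurable X]setTI; exact: measurable_tnth.
by apply/seteqP; split=> [z Az i _|z Az i]; exact: Az.
Qed.

End iid_law.

Section sample.
Context (R : realType).

(* The number of points strictly to the left of (resp. below) the l-th point:
   its 0-based rank from the lowest coordinate. *)
Definition xrank (n : nat) (z : n.-tuple (R * R)) (l : 'I_n) : nat :=
  #|[set m : 'I_n | (tnth z m).1 < (tnth z l).1]%SET|.

Definition yrank (n : nat) (z : n.-tuple (R * R)) (l : 'I_n) : nat :=
  #|[set m : 'I_n | (tnth z m).2 < (tnth z l).2]%SET|.

Definition is_Perm (n : nat) (z : n.-tuple (R * R)) (s : 'S_n) : bool :=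
  [forall i : 'I_n, forall j : 'I_n, forall l : 'I_n,
    (xrank z l == i) && (yrank z l == j) ==> (s i == j)].

(* By PermP, this is determined by is_Perm when the coordinates are distinct;
   otherwise the value of Perm z is irrelevant. *)
Definition Perm (n : nat) (z : n.-tuple (R * R)) : 'S_n :=
  odflt 1%g [pick s | is_Perm z s].

Let card_lt_inj (n : nat) (f : 'I_n -> R) : injective f ->
  injective (fun l => #|[set m : 'I_n | f m < f l]%SET|).
Proof.
move=> finj.
have mono a b : f a < f b ->
    (#|[set m : 'I_n | (f m < f a)%R]%SET| <
     #|[set m : 'I_n | (f m < f b)%R]%SET|)%N.
  move=> ab; apply: proper_card; apply/properP; split.
    by apply/fintype.subsetP => m; rewrite !inE => ma; exact: lt_trans ma ab.
  by exists a; rewrite !inE ?ab ?ltxx.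
move=> l m /= lm; apply: finj; apply/eqP.
by case: ltgtP => // /mono; rewrite lm ltnn.
Qed.

Let card_lt_ord (n : nat) (f : 'I_n -> R) (l : 'I_n) :
  (#|[set m : 'I_n | (f m < f l)%R]%SET| < n)%N.
Proof.
rewrite -[X in (_ < X)%N]card_ord; apply: proper_card; apply/properP.
split; first exact: subset_predT.
by exists l; rewrite ?inE ?ltxx.
Qed.

Lemma PermP (n : nat) (z : n.-tuple (R * R)) (s : 'S_n) :
  injective (fun l => (tnth z l).1) -> injective (fun l => (tnth z l).2) ->
  is_Perm z s <-> s = Perm z.
Proof.
move=> xinj yinj.
pose fx l := Ordinal (card_lt_ord (fun l => (tnth z l).1) l).
pose fy l := Ordinal (card_lt_ord (fun l => (tnth z l).2) l).
have fxi : injective fx by move=> a b /(congr1 val); exact: (card_lt_inj xinj).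
have fyi : injective fy by move=> a b /(congr1 val); exact: (card_lt_inj yinj).
have isP t : is_Perm z t <-> forall l, t (fx l) = fy l.
  split=> [/forallP H l|H].
    have /forallP/(_ (fy l))/forallP/(_ l) := H (fx l).
    by rewrite /xrank /yrank !eqxx => /eqP.
  apply/forallP => i; apply/forallP => j; apply/forallP => l.
  apply/implyP => /andP[/eqP xi /eqP yj].
  have -> : i = fx l by apply/val_inj; exact: (esym xi).
  have -> : j = fy l by apply/val_inj; exact: (esym yj).
  exact/eqP.
have uniqP t u : is_Perm z t -> is_Perm z u -> t = u.
  move=> /isP Ht /isP Hu; apply/permP => i.
  have [g _ gK] := injF_bij fxi.
  by rewrite -(gK i); exact: etrans (Ht _) (esym (Hu _)).
have ex : is_Perm z ((perm fxi)^-1 * perm fyi)%g.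
  apply/isP => l; have <- : perm fxi l = fx l by rewrite permE.
  by rewrite permM permK permE.
have PermS : is_Perm z (Perm z).
  by rewrite /Perm; case: pickP => //= noP; rewrite noP in ex.
by split=> [Ps|->//]; exact: uniqP.
Qed.

Definition Sample (mu : probability (R * R)%type R) (n : nat)
    (A : set 'S_n) : \bar R :=
  iid_law mu n (@Perm n @^-1` A).

(* s is a random permutation ('S_n being discrete) whose law is nu. *)
Definition has_law (d : measure_display) (W : measurableType d)
    (P : probability W R) (n : nat) (s : W -> 'S_n)
    (nu : set 'S_n -> \bar R) : Prop :=
  forall A : set 'S_n, measurable (s @^-1` A) /\ P (s @^-1` A) = nu A.

End sample.

(* Main.v *)
(** Both limits are instances of one statement, with a direction [b].

    Lower bound: if [A] is closed and [k]-monotone with mass close to the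
    supremum, the sample points lying in [A] form [k] monotone subsequences,
    and their number is concentrated around [n * mu A].

    Upper bound: cut the square into a finite grid.  The cells met by a
    monotone subsequence form a grid-monotone set of cells, so LIS_k is at most
    the number of points falling in a union of [k] such sets; there are
    finitely many of them, so all the counts are simultaneously concentrated.
    Refining the grid, the largest mass of such a union cannot stay above the
    supremum: a limit of the unions along an ultrafilter is closed and
    [k]-monotone and has at least the limiting mass.

    Concentration is exponential, so the deviation probabilities are summable
    and Borel-Cantelli applies whatever the joint law of the permutations. *)
Require Import Defs.
From HB Require Import structures.
From mathcomp Require Import all_boot all_order all_algebra all_fingroup.
From mathcomp Require Import all_classical all_reals all_analysis.
From mathcomp Require Import measurable_realfun ring lra.
Set Implicit Arguments.
Unset Strict Implicit.
Unset Printing Implicit Defensive.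
Import Order.TTheory GRing.Theory Num.Theory.
Import numFieldNormedType.Exports.
Local Open Scope classical_set_scope.
Local Open Scope ring_scope.

(** * Union bound and an exponential estimate *)

Lemma measure_finite_union_le (d : measure_display) (T : measurableType d)
    (R : realType) (m : {measure set T -> \bar R}) (I : finType) (Q : pred I)
    (F : I -> set T) (A : set T) :
  (forall i, measurable (F i)) -> measurable A ->
  (forall t, A t -> exists2 i, Q i & F i t) ->
  (m A <= \sum_(i | Q i) m (F i))%E.
Proof.
move=> mF mA AF.
have := @content_sub_fsum _ _ _ m I [set` Q] A F (@finite_finset _ _) (fun i _ => mF i) mA.
move=> /(_ _)/le_trans; apply; first by move=> t /AF[i Qi Fi]; exists i.
by rewrite -(@bigfs _ _ _ _ (index_enum I)) ?index_enum_uniq// => i _; rewrite mem_index_enum.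
Qed.

(** From $1-x\le e^{-x}$ one gets $(1-x)e^x\le 1$, while $(1-x)(1+x+2x^2)=1+x^2(1-2x)\ge 1$ on this
    range. *)
Lemma expR_le_quadratic (R : realType) (x : R) :
  0 <= x -> x <= 2^-1 -> expR x <= 1 + x + 2 * x ^+ 2.
Proof.
move=> x0 x1.
have h := expR_ge1Dx (- x).
have e0 := expR_gt0 x.
rewrite expRN in h.
have : (1 - x) * expR x <= 1 by rewrite -ler_pdivlMr// div1r.
have : 1 <= (1 - x) * (1 + x + 2 * x ^+ 2) by nra.
nra.
Qed.

(** * Exponential concentration of the number of sample points in a set *)

Section concentration.
Context (d : measure_display) (T : measurableType d) (R : realType).
Variable mu : probability T R.
Implicit Types (B : set T) (n : nat).

Definition hits n B (z : n.-tuple T) : {set 'I_n} :=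
  [set i | tnth z i \in B]%SET.

Lemma hitsP n B (z : n.-tuple T) i : reflect (B (tnth z i)) (i \in hits B z).
Proof. by rewrite inE; apply: (iffP idP) => [/set_mem|/mem_set]. Qed.

Lemma measurable_iid_rect n (A : 'I_n -> set T) :
  (forall i, measurable (A i)) ->
  measurable [set z : n.-tuple T | forall i, A i (tnth z i)].
Proof.
move=> mA.
rewrite (_ : [set _ | _] = \bigcap_(i in [set: 'I_n]) ((@tnth n T)^~ i @^-1` A i)).
  apply: fin_bigcap_measurable => // i _.
  by rewrite -[X in measurable X]setTI; exact: measurable_tnth.
by apply/seteqP; split=> [z Az i _|z Az i]; exact: Az.
Qed.

(** Rectangle form of the event: it yields measurability, and the probability through
    [iid_law_rect]. *)
Lemma hitsE n B (S : {set 'I_n}) :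
  [set z | hits B z = S] =
  [set z : n.-tuple T | forall i, (if i \in S then B else ~` B) (tnth z i)].
Proof.
apply/seteqP; split=> z /=.
  by move=> <- i; rewrite inE; case: ifPn => [/set_mem//|/negP zB /mem_set].
move=> h; apply/setP => i; rewrite inE; have := h i.
by case: ifPn => _ zi; [exact: mem_set|apply/negbTE/negP => /set_mem].
Qed.

Lemma measurable_hits n B (Q : {set 'I_n} -> Prop) : measurable B ->
  measurable [set z : n.-tuple T | Q (hits B z)].
Proof.
move=> mB.
rewrite (_ : [set _ | _] = \bigcup_(S in Q) [set z : n.-tuple T | hits B z = S]).
  apply: fin_bigcup_measurable => // S _.
  rewrite hitsE; apply: (@measurable_iid_rect _ (fun i => if i \in S then B else ~` B)) => i.
  by case: ifP => // _; exact: measurableC.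
by apply/seteqP; split=> [z Qz|z [S QS /= ->]//]; exists (hits B z).
Qed.

Lemma iid_law_hits n B (S : {set 'I_n}) : measurable B ->
  iid_law mu n [set z | hits B z = S] =
  (\prod_(i < n) (if i \in S then fine (mu B) else 1 - fine (mu B)))%:E.
Proof.
move=> mB; rewrite hitsE (@iid_law_rect _ _ _ mu n (fun i => if i \in S then B else ~` B)); last first.
  by move=> i; case: ifP => // _; exact: measurableC.
rewrite -prodEFin; apply: eq_bigr => i _.
by case: ifP => _; rewrite ?probability_setC// ?EFinB fineK// fin_num_measure.
Qed.

(* Chernoff's method, the exponential moment being a finite sum over the
   possible values of [hits B z]. *)
Lemma hits_upper_tail n B (e : R) : measurable B -> 0 < e -> e <= 1 ->
  (iid_law mu n [set z | (n%:R * (fine (mu B) + e) <= #|hits B z|%:R)%R] <=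
   (expR (- (e ^+ 2 / 8)) ^+ n)%:E)%E.
Proof.
move=> mB e0 e1; set p := fine (mu B).
have p0 : 0 <= p by exact: fine_ge0.
have p1 : p <= 1.
  by rewrite -lee_fin fineK ?fin_num_measure//; exact: probability_le1.
pose x := e / 4. (* the Chernoff parameter *)
set Q := fun S : {set 'I_n} => n%:R * (p + e) <= #|S|%:R.
pose F (S : {set 'I_n}) := [set z : n.-tuple T | hits B z = S].
apply: le_trans.
  apply: (@measure_finite_union_le _ _ _ (iid_law mu n) _ Q F).
  - by move=> S; exact: (@measurable_hits _ _ (fun S' => S' = S)).
  - exact: (@measurable_hits _ _ Q).
  - by move=> z Qz; exists (hits B z).
rewrite [leLHS](_ : _ =
    (\sum_(S | Q S) \prod_(i < n) (if i \in S then p else 1 - p))%:E); last first.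
  by rewrite -sumEFin; apply: eq_bigr => S _; exact: iid_law_hits.
rewrite lee_fin.
(* Markov's inequality: each term with [Q S] is weighted by $e^{x(|S|-n(p+e))}\ge 1$, and then the
   restriction to [Q] is dropped. *)
apply: (@le_trans _ _ (\sum_(S : {set 'I_n}) (expR (- (x * (p + e)))) ^+ n *
    \prod_(i < n) (if i \in S then p * expR x else 1 - p))).
  rewrite [leRHS](bigID Q)/= -[leLHS]addr0; apply: lerD.
    apply: ler_sum => S QS.
    have -> : \prod_(i < n) (if i \in S then p * expR x else 1 - p) =
       expR (x * #|S|%:R) * \prod_(i < n) (if i \in S then p else 1 - p).
      rewrite (bigID (mem S)) [X in _ = _ * X](bigID (mem S))/= mulrA.
      congr (_ * _); last first.
        by apply: eq_bigr => i /negbTE ->.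
      rewrite expRM_natr -prodr_const -big_split/=.
      by apply: eq_bigr => i ->; rewrite mulrC.
    rewrite mulrA ler_peMl//.
      by apply: prodr_ge0 => i _; case: ifP => _; rewrite ?subr_ge0.
    rewrite -expRM_natr -expRD -[leLHS]expR0 ler_expR.
    have : x * (n%:R * (p + e)) <= x * #|S|%:R by rewrite ler_pM2l ?divr_gt0.
    lra.
  apply: sumr_ge0 => S _; rewrite mulr_ge0 ?exprn_ge0 ?expR_ge0//.
  by apply: prodr_ge0 => i _; case: ifP => _; rewrite ?subr_ge0 ?mulr_ge0 ?expR_ge0.
rewrite -big_distrr/=.
(* Expanding the $n$-th power by distributivity gives one product for each subset [S]. *)
have -> : \sum_(S : {set 'I_n}) \prod_(i < n) (if i \in S then p * expR x else 1 - p) =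
    (p * expR x + (1 - p)) ^+ n.
  rewrite -[in RHS](card_ord n) -prodr_const bigA_distr; apply: eq_bigr => S _.
  by rewrite (bigID (mem S))/=; congr (_ * _); apply: eq_big => // i; rewrite ?inE// => [->//|/negbTE ->].
have m0 : 0 <= p * expR x + (1 - p).
  by rewrite addr_ge0 ?mulr_ge0 ?expR_ge0// subr_ge0.
rewrite -exprMn; apply: lerXn2r; rewrite ?nnegrE ?expR_ge0//.
  by rewrite mulr_ge0 ?expR_ge0.
have x0 : 0 <= x by rewrite divr_ge0 ?ltW.
have xh : x <= 2^-1 by rewrite /x; lra.
have := expR_le_quadratic x0 xh => ex.
(* The base is at most $1+u\le e^u$ with $u=p(x+2x^2)$. *)
apply: (@le_trans _ _ (expR (- (x * (p + e))) * expR (p * (x + 2 * x ^+ 2)))).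
  rewrite ler_pM2l ?expR_gt0//; apply: le_trans (expR_ge1Dx _).
  by nra.
(* The exponent is $-xe+2px^2\le -e^2/4+e^2/8$, since $x=e/4$ and $p\le 1$. *)
rewrite -expRD ler_expR /x.
nra.
Qed.

Lemma hits_setC n B (z : n.-tuple T) : hits (~` B) z = (~: hits B z)%SET.
Proof. by apply/setP => i; rewrite !inE in_setC. Qed.

Lemma hits_lower_tail n B (e : R) : measurable B -> 0 < e -> e <= 1 ->
  (iid_law mu n [set z | (#|hits B z|%:R <= n%:R * (fine (mu B) - e))%R] <=
   (expR (- (e ^+ 2 / 8)) ^+ n)%:E)%E.
Proof.
move=> mB e0 e1; have := @hits_upper_tail n (~` B) e (measurableC mB) e0 e1.
apply: le_trans; rewrite le_eqVlt; apply/orP; left; apply/eqP.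
congr (iid_law mu n _); apply/funext => z /=; apply/propext.
rewrite hits_setC probability_setC// fineB ?fin_num_measure//=.
have /(congr1 (fun k => k%:R : R)) := cardsC (hits B z).
by rewrite natrD card_ord; split; lra.
Qed.

End concentration.

(** * Marginals of the sample and almost sure absence of ties *)

Lemma iid_law_coord (d : measure_display) (T : measurableType d) (R : realType)
    (mu : probability T R) n (j : 'I_n) (B : set T) : measurable B ->
  iid_law mu n [set z | B (tnth z j)] = mu B.
Proof.
move=> mB; pose A i := if i == j then B else setT.
rewrite (_ : [set _ | _] = [set z : n.-tuple T | forall i, A i (tnth z i)]).
  rewrite iid_law_rect => [|i]; last by rewrite /A; case: ifP.
  rewrite (bigD1 j)//= /A eqxx big1 ?mule1// => i /negbTE ->.
  exact: probability_setT.
apply/seteqP; split=> z /= zj; last by have := zj j; rewrite /A eqxx.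
by move=> i; rewrite /A; case: eqP => // ->.
Qed.

Section no_ties.
Context (d : measure_display) (T : measurableType d) (R : realType).
Variables (mu : probability T R) (f : T -> R).
Hypothesis mf : measurable_fun setT f.
Hypothesis f0 : forall x, mu (f @^-1` [set x]) = 0%E.

Definition ties n : set (n.-tuple T) :=
  [set z | exists i j : 'I_n, i != j /\ f (tnth z i) = f (tnth z j)].
Arguments ties : clear implicits.

Lemma measurable_eq_fun (d' : measure_display) (U : measurableType d')
    (g h : U -> R) : measurable_fun setT g -> measurable_fun setT h ->
  measurable [set u | g u = h u].
Proof.
move=> mg mh; rewrite -[X in measurable X]setTI.
have -> : [set u | g u = h u] = (fun u => g u == h u) @^-1` [set true].
  by apply/seteqP; split=> u /= /eqP.
by apply: measurable_fun_eqr.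
Qed.

Lemma measurable_f_tnth n (i : 'I_n) :
  measurable_fun setT (fun z : n.-tuple T => f (tnth z i)).
Proof. by apply: measurableT_comp => //; exact: measurable_tnth. Qed.

Lemma measurable_ties n : measurable (ties n).
Proof.
rewrite (_ : ties n = \bigcup_(p in [set p : 'I_n * 'I_n | p.1 != p.2])
    [set z : n.-tuple T | f (tnth z p.1) = f (tnth z p.2)]).
  apply: fin_bigcup_measurable => // p _.
  by apply: measurable_eq_fun; exact: measurable_f_tnth.
apply/seteqP; split=> z [].
  by move=> i [j [ij zij]]; exists (i, j).
by move=> p pP zp; exists p.1, p.2.
Qed.

(** Induction on the size: a tie either lies among the last [n] points or involves the first one. In
    the second case, once the first point [x] is fixed, the [j]-th one must fall in the null fibre
    of [f] over [f x], and integrating over [x] gives 0. *)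
Lemma iid_law_ties n : iid_law mu n (ties n) = 0%E.
Proof.
elim: n => [|n IHn] /=.
  rewrite (_ : ties 0 = set0) ?measure0//.
  by apply/seteqP; split=> // z [[]].
rewrite /distribution /pushforward; set C := _ @^-1` _.
pose D (j : 'I_n) := [set p : T * n.-tuple T | f p.1 = f (tnth p.2 j)].
have mD j : measurable (D j).
  apply: measurable_eq_fun; first exact: measurableT_comp.
  by apply: (measurableT_comp (measurable_f_tnth j)).
have mfx x : measurable (f @^-1` [set x]).
  by rewrite -[X in measurable X]setTI; exact: mf.
have D0 j : ((mu \x iid_law mu n)%E (D j) = 0)%E.
  rewrite /product_measure1; apply: integral0_eq => x _ /=.
  rewrite -[RHS](f0 (f x)) -(iid_law_coord mu j (mfx (f x))); congr (iid_law mu n _).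
  by apply/seteqP; split=> z; rewrite /xsection/= inE => h; exact: esym h.
have T0 : ((mu \x iid_law mu n)%E (setT `*` ties n) = 0)%E.
  by rewrite product_measure1E//; [rewrite [X in (_ * X)%E](_ : _ = 0%E) ?mule0|exact: measurable_ties].
pose F (o : option 'I_n) := if o is Some j then D j else setT `*` ties n.
have mC : measurable C.
  rewrite -[X in measurable X]setTI; apply: measurable_pair_cons => //.
  exact: measurable_ties.
apply/eqP; rewrite -measure_le0.
apply: le_trans.
  apply: (@measure_finite_union_le _ _ _ _ _ xpredT F) => //.
  - move=> [j|]; first exact: mD.
    by apply: measurableX => //; exact: measurable_ties.
  - move=> [x z] [i [j [ij]]]; rewrite /pair_cons/=.
    case: (unliftP ord0 i) ij => [i' ->|->]; case: (unliftP ord0 j) => [j' ->|->].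
    + move=> ij; rewrite !tnthS => e; exists None => //; split => //=.
      by exists i', j'; split=> //; apply: contra ij => /eqP ->.
    + by move=> _; rewrite tnthS => e; exists (Some i').
    + by move=> _; rewrite tnthS => e; exists (Some j').
    + by rewrite eqxx.
by rewrite big1// => -[j|] _; [exact: D0|exact: T0].
Qed.

End no_ties.

(** * Measurability of the sampled permutation *)

Section perm_measurable.
Context (R : realType).

Definition order_code n (z : n.-tuple (R * R)) :
    {ffun 'I_n * 'I_n -> bool * bool} :=
  [ffun p => ((tnth z p.1).1 < (tnth z p.2).1, (tnth z p.1).2 < (tnth z p.2).2)].

Lemma Perm_order_code n (z z' : n.-tuple (R * R)) :
  order_code z = order_code z' -> Defs.Perm z = Defs.Perm z'.
Proof.
move=> zz'.
have zP l m : ((tnth z l).1 < (tnth z m).1, (tnth z l).2 < (tnth z m).2) =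
    ((tnth z' l).1 < (tnth z' m).1, (tnth z' l).2 < (tnth z' m).2).
  by have := congr1 (fun g : {ffun _} => g (l, m)) zz'; rewrite !ffunE.
have xz l : xrank z l = xrank z' l.
  by apply: eq_card => m; rewrite !inE; have [] := zP m l.
have yz l : yrank z l = yrank z' l.
  by apply: eq_card => m; rewrite !inE; have [] := zP m l.
rewrite /Defs.Perm; congr odflt; apply: eq_pick => s; rewrite /is_Perm.
apply: eq_forallb => i; apply: eq_forallb => j; apply: eq_forallb => l.
by rewrite xz yz.
Qed.

(* [Perm z] depends only on [order_code z], which has finitely many values. *)
Lemma measurable_Perm n (A : set 'S_n) : measurable (@Defs.Perm R n @^-1` A).
Proof.
pose D := [set c | exists2 z : n.-tuple (R * R), order_code z = c & A (Defs.Perm z)].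
rewrite (_ : _ @^-1` A = \bigcup_(c in D) [set z | order_code z = c]).
  apply: fin_bigcup_measurable => // c _.
  rewrite (_ : [set _ | _] = \bigcap_(p in [set: 'I_n * 'I_n])
    [set z : n.-tuple (R * R) |
      ((tnth z p.1).1 < (tnth z p.2).1) = (c p).1 /\
      ((tnth z p.1).2 < (tnth z p.2).2) = (c p).2]).
    apply: fin_bigcap_measurable => // p _; apply: measurableI.
      rewrite -[X in measurable X]setTI.
      apply: (@measurable_fun_ltr _ _ _ setT (fun z : n.-tuple (R * R) => (tnth z p.1).1)
        (fun z => (tnth z p.2).1) _ _ measurableT [set (c p).1]) => //;
        by apply: measurableT_comp => //; exact: measurable_tnth.
    rewrite -[X in measurable X]setTI.
    apply: (@measurable_fun_ltr _ _ _ setT (fun z : n.-tuple (R * R) => (tnth z p.1).2)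
        (fun z => (tnth z p.2).2) _ _ measurableT [set (c p).2]) => //;
        by apply: measurableT_comp => //; exact: measurable_tnth.
  apply/seteqP; split=> z /=.
    by move=> <- p _; rewrite ffunE.
  by move=> zc; apply/ffunP => p; rewrite ffunE; case: (zc p) => // -> ->; case: (c p).
apply/seteqP; split=> z /= Az; first by exists (order_code z) => //; exists z.
by case: Az => c [z' <- Az'] /= /Perm_order_code ->.
Qed.

End perm_measurable.

(** * Monotone sets versus monotone subsequences *)

Section directions.
Context (R : realType).

(* The boolean selects the increasing (true) or the decreasing (false) half of
   the theorem. *)
Definition monotone_subset (b : bool) : set (R * R) -> Prop :=
  if b then @nondecreasing_subset R else @nonincreasing_subset R.

Definition monotone_subseq (b : bool) n (s : 'S_n) : {set 'I_n} -> bool :=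
  if b then increasing_subseq s else decreasing_subseq s.

Definition longest (b : bool) (k n : nat) (s : 'S_n) : nat :=
  \max_(I : {ffun 'I_k -> {set 'I_n}} | [forall a, monotone_subseq b s (I a)])
    #|(\bigcup_(a < k) I a)%SET|.

Definition k_monotone (b : bool) (k : nat) (A : set (R * R)) : Prop :=
  exists2 B : 'I_k -> set (R * R),
    (forall a, monotone_subset b (B a)) & A = \bigcup_a B a.

Definition longest_tilde (b : bool) (k : nat)
    (mu : probability (R * R)%type R) : \bar R :=
  ereal_sup [set mu A | A in
    [set A | [/\ closed A, A `<=` unit_square R & k_monotone b k A]]].

Definition ltn_dir (b : bool) (i j : nat) : bool :=
  if b then (i < j)%N else (j < i)%N.

Definition ltr_dir (b : bool) (x y : R) : bool := if b then x < y else y < x.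

(** Comparison with a margin [e]: a grid of mesh [e] detects the order of two coordinates only when
    they are at least this far apart. *)
Definition ltr_dir_by (b : bool) (e x y : R) : bool :=
  if b then x + e <= y else y + e <= x.

Lemma monotone_subseqP b n (s : 'S_n) (I : {set 'I_n}) :
  reflect (forall i j, i \in I -> j \in I -> (i < j)%N -> ltn_dir b (s i) (s j))
    (monotone_subseq b s I).
Proof.
case: b; apply: (iffP forall_inP) => h.
- by move=> i j iI jI ij; have /forall_inP/(_ j jI)/implyP/(_ ij) := h i iI.
- by move=> i iI; apply/forall_inP => j jI; apply/implyP; exact: h.
- by move=> i j iI jI ij; have /forall_inP/(_ j jI)/implyP/(_ ij) := h i iI.
- by move=> i iI; apply/forall_inP => j jI; apply/implyP; exact: h.
Qed.

(** Points with equal abscissae make the product vanish, so only strictly ordered abscissae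
    constrain the set. *)
Lemma monotone_subsetP b (A : set (R * R)) :
  monotone_subset b A <->
  (forall p q, A p -> A q -> p.1 < q.1 -> ~~ ltr_dir b q.2 p.2).
Proof.
case: b; split => /= h p q Ap Aq.
- by move=> pq; have := h p q Ap Aq; rewrite -leNgt pmulr_rge0 ?subr_ge0// subr_gt0.
- have := h p q Ap Aq; have := h q p Aq Ap; rewrite /= -!leNgt => h1 h2.
  have [pq|pq|->] := ltgtP p.1 q.1; last by rewrite subrr mul0r.
    by have := h2 pq; nra.
  by have := h1 pq; nra.
- by move=> pq; have := h p q Ap Aq; rewrite -leNgt pmulr_rle0 ?subr_le0// subr_gt0.
- have := h p q Ap Aq; have := h q p Aq Ap; rewrite /= -!leNgt => h1 h2.
  have [pq|pq|->] := ltgtP p.1 q.1; last by rewrite subrr mul0r.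
    by have := h2 pq; nra.
  by have := h1 pq; nra.
Qed.

Lemma ltn_card_lt n (f : 'I_n -> R) (l m : 'I_n) :
  (#|[set i : 'I_n | (f i < f l)%R]%SET| < #|[set i : 'I_n | (f i < f m)%R]%SET|)%N =
  (f l < f m).
Proof.
apply/idP/idP => [|lm].
  apply: contraLR; rewrite -leNgt -leqNgt => ml.
  apply: subset_leq_card; apply/fintype.subsetP => i; rewrite !inE => im.
  exact: lt_le_trans ml.
apply: proper_card; apply/properP; split.
  by apply/fintype.subsetP => i; rewrite !inE => il; exact: lt_trans lm.
by exists l; rewrite !inE ?lm ?ltxx.
Qed.

Lemma card_lt_ord n (f : 'I_n -> R) (l : 'I_n) :
  (#|[set i : 'I_n | (f i < f l)%R]%SET| < n)%N.
Proof.
rewrite -[X in (_ < X)%N]card_ord; apply: proper_card; apply/properP.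
by split; [exact: subset_predT|exists l; rewrite ?inE ?ltxx].
Qed.

(* [g l] is the rank of the abscissa of the l-th point. *)
Lemma Perm_order n (z : n.-tuple (R * R)) :
  injective (fun l => (tnth z l).1) -> injective (fun l => (tnth z l).2) ->
  exists g : 'S_n, forall l m,
    ((g l < g m)%N = ((tnth z l).1 < (tnth z m).1)) /\
    ((Defs.Perm z (g l) < Defs.Perm z (g m))%N = ((tnth z l).2 < (tnth z m).2)).
Proof.
move=> xinj yinj.
pose fx l : 'I_n := Ordinal (card_lt_ord (fun l => (tnth z l).1) l).
pose fy l : 'I_n := Ordinal (card_lt_ord (fun l => (tnth z l).2) l).
have fx_inj : injective fx.
  move=> l m lm; apply: xinj.
  have h l' m' := ltn_card_lt (fun l => (tnth z l).1) l' m'.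
  have e : #|[set i : 'I_n | (tnth z i).1 < (tnth z l).1]%SET| =
      #|[set i : 'I_n | (tnth z i).1 < (tnth z m).1]%SET|.
    exact: (congr1 val lm).
  have := h l m; have := h m l.
  by rewrite e ltnn; case: ltgtP.
have PermE l : Defs.Perm z (fx l) = fy l.
  have /forallP/(_ (fx l))/forallP/(_ (fy l))/forallP/(_ l) :=
    (PermP (Defs.Perm z) xinj yinj).2 erefl.
  by rewrite /xrank /yrank !eqxx => /eqP.
exists (perm fx_inj) => l m; rewrite !permE !PermE.
by split; [exact: (ltn_card_lt (fun l => (tnth z l).1))
          |exact: (ltn_card_lt (fun l => (tnth z l).2))].
Qed.

(** The ranks of the sample points in one monotone piece form a monotone subsequence; distinct
    ordinates turn the weak inequality of the piece into a strict one. *)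
Lemma hits_le_longest b k n (z : n.-tuple (R * R)) (A : set (R * R)) :
  injective (fun l => (tnth z l).1) -> injective (fun l => (tnth z l).2) ->
  k_monotone b k A -> (#|hits A z| <= longest b k (Defs.Perm z))%N.
Proof.
move=> xinj yinj [B mB AB].
have [g gP] := Perm_order xinj yinj.
pose I := [ffun a : 'I_k => (g @: hits (B a) z)%SET].
have IP : [forall a, monotone_subseq b (Defs.Perm z) (I a)].
  apply/forallP => a; apply/monotone_subseqP => i j; rewrite !ffunE.
  move=> /imsetP[l /hitsP lB ->] /imsetP[m /hitsP mB' ->].
  have [-> _] := gP l m => lm.
  have /monotone_subsetP/(_ _ _ lB mB' lm) := mB a.
  have l_neq_m : (tnth z l).2 != (tnth z m).2.
    by apply/eqP => /yinj e; move: lm; rewrite e ltxx.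
  rewrite /ltr_dir /ltn_dir (gP l m).2 (gP m l).2.
  by case: (b); rewrite -?leNgt le_eqVlt ?(negbTE l_neq_m)// eq_sym (negbTE l_neq_m).
apply: leq_trans (leq_bigmax_cond _ IP).
rewrite -(card_imset _ (@perm_inj _ g)); apply: subset_leq_card.
apply/fintype.subsetP => i /imsetP[l /hitsP]; rewrite AB => -[a _ Ba] ->.
apply/finset.bigcupP; exists a => //; rewrite ffunE; apply: imset_f.
exact/hitsP.
Qed.

(** * Discretisation of the square *)

Section grid.
Variable N : nat.

(** There are [N.+1] indices because the endpoint 1 gets index [N]. The default value of [inord] can
    occur only outside the unit interval. *)
Definition cell (t : R) : 'I_N.+1 := inord (Num.truncn (N%:R * t)).

Definition region (S : {set 'I_N.+1 * 'I_N.+1}) : set (R * R) :=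
  unit_square R `&` [set p | (cell p.1, cell p.2) \in S].

(** Only pairs of cells strictly ordered in both coordinates are constrained: inside a common row or
    column the grid does not see the order of the points. *)
Definition grid_monotone b (S : {set 'I_N.+1 * 'I_N.+1}) : bool :=
  [forall c in S, forall c' in S, ~~ ((c.1 < c'.1)%N && ltn_dir b c'.2 c.2)].

Lemma val_cell (t : R) : t \in `[0, 1] -> cell t = Num.truncn (N%:R * t) :> nat.
Proof.
rewrite in_itv/= => /andP[t0 t1]; rewrite inordK// ltnS truncn_le_nat.
by apply: le_lt_trans (_ : N%:R < _); [rewrite ler_piMr|rewrite ltr_nat].
Qed.

Lemma cell_le (t u : R) : t \in `[0, 1] -> u \in `[0, 1] -> t <= u ->
  (cell t <= cell u)%N.
Proof.
move=> t01 u01 tu; rewrite !val_cell//.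
by apply: le_truncn; rewrite ler_wpM2l.
Qed.

Lemma cell_lt (t u : R) : (0 < N)%N -> t \in `[0, 1] -> u \in `[0, 1] ->
  t + N%:R^-1 <= u -> (cell t < cell u)%N.
Proof.
move=> N0 t01 u01 tu; rewrite !val_cell//.
have {}N0 : 0 < N%:R :> R by rewrite ltr0n.
move: t01; rewrite in_itv/= => /andP[t0 t1].
have Nt0 : 0 <= N%:R * t by rewrite mulr_ge0// ltW.
have NtNu : N%:R * t + 1 <= N%:R * u.
  rewrite -[X in _ + X <= _](mulfV (lt0r_neq0 N0)) -mulrDr.
  by rewrite ler_pM2l.
rewrite truncn_ge_nat; last by lra.
by apply: le_trans NtNu; rewrite -natr1 lerD2r truncn_le.
Qed.

(** Since [cell] is monotone on the unit interval, its fibres there are intervals, and a region is a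
    finite union of products of such intervals. *)
Lemma measurable_region S : measurable (region S).
Proof.
pose J (i : 'I_N.+1) : set R := [set t | t \in `[0, 1] /\ cell t = i].
have mJ i : measurable (J i).
  apply: is_interval_measurable => t u [t01 ti] [u01 ui] v /andP[tv vu].
  have v01 : v \in `[0, 1].
    move: t01 u01; rewrite !in_itv/= => /andP[? _] /andP[_ ?].
    by apply/andP; split; [exact: le_trans tv|exact: le_trans vu _].
  split=> //; apply/val_inj/eqP; rewrite eqn_leq.
  by rewrite -[X in (_ <= val X)%N]ui -[X in _ && (val X <= _)%N]ti !cell_le.
rewrite (_ : region S = \bigcup_(c in [set` S]) (J c.1 `*` J c.2)).
  by apply: fin_bigcup_measurable => // c _; exact: measurableX.
apply/seteqP; split=> p.
  by move=> [[/= p1 p2] pS]; exists (cell p.1, cell p.2).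
by move=> [c cS [[p1 c1] [p2 c2]]]; split; [split|rewrite /= c1 c2 -surjective_pairing].
Qed.

(** Coordinates separated by at least the mesh fall in strictly ordered cells, so a violation with
    this margin would appear among the cells of [S]. *)
Lemma region_monotone b S (p q : R * R) : (0 < N)%N -> grid_monotone b S ->
  region S p -> region S q -> p.1 + N%:R^-1 <= q.1 ->
  ~~ ltr_dir_by b N%:R^-1 q.2 p.2.
Proof.
move=> N0 /forall_inP Sm [[p1 p2] /= /Sm/forall_inP pS] [[q1 q2] /= /pS].
move=> + pq; rewrite /= cell_lt//= /ltn_dir /ltr_dir_by.
by case: (b); apply: contra => ?; exact: cell_lt.
Qed.

(** Deterministic half of the upper bound: covering each subsequence by the cells that it meets
    reduces all families of subsequences to finitely many families of cells. *)
Lemma longest_grid b k n (z : n.-tuple (R * R)) (M : nat) :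
  injective (fun l => (tnth z l).1) -> injective (fun l => (tnth z l).2) ->
  (forall l, unit_square R (tnth z l)) ->
  (forall S : {ffun 'I_k -> {set 'I_N.+1 * 'I_N.+1}},
    (forall a, grid_monotone b (S a)) ->
    (#|hits (\bigcup_a region (S a)) z| <= M)%N) ->
  (longest b k (Defs.Perm z) <= M)%N.
Proof.
move=> xinj yinj z01 SM.
have [g gP] := Perm_order xinj yinj.
apply/bigmax_leqP => I /forallP IP.
(* The cells visited by the [a]-th subsequence; the preimage under [g] turns its ranks back into
   sample labels. *)
pose S := [ffun a : 'I_k =>
  [set (cell (tnth z l).1, cell (tnth z l).2) | l in (g @^-1: I a)%SET]%SET].
apply: leq_trans (SM S _).
  rewrite -(card_preimset _ (@perm_inj _ g)); apply: subset_leq_card.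
  apply/fintype.subsetP => l; rewrite inE => /finset.bigcupP[a _ lI].
  apply/hitsP; exists a => //; split; first exact: z01.
  by rewrite /= ffunE; apply: imset_f; rewrite inE.
move=> a; apply/forall_inP => c; rewrite ffunE => /imsetP[l]; rewrite inE => lI -> /=.
apply/forall_inP => c' /imsetP[m]; rewrite inE => mI -> /=.
have /monotone_subseqP IPa := IP a.
have x01 i : (tnth z i).1 \in `[0, 1] by have [] := z01 i.
have y01 i : (tnth z i).2 \in `[0, 1] by have [] := z01 i.
rewrite negb_and; case: leqP => //= lm.
have {}lm : (tnth z l).1 < (tnth z m).1.
  by move: lm; apply: contraLR; rewrite -leNgt -leqNgt; exact: cell_le.
have := IPa _ _ lI mI; rewrite (gP l m).1 => /(_ lm).
rewrite /ltn_dir (gP l m).2 (gP m l).2.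
by case: (b); rewrite -leqNgt => /ltW; exact: cell_le.
Qed.

End grid.

End directions.

(** * A countable base of the plane *)

Section boxes.
Context (R : realType).

(** Open squares with rational centre and radius $1/(j+1)$, enumerated through [unpickle]; an
    integer coding nothing gives the empty box. *)
Definition box (i : nat) : set (R * R) :=
  if unpickle i is Some (q1, q2, j)
  then [set p | `|p.1 - ratr q1| < j.+1%:R^-1 /\ `|p.2 - ratr q2| < j.+1%:R^-1]
  else set0.

Lemma box_small (p : R * R) (e : R) : 0 < e ->
  exists2 i, box i p &
    forall q, box i q -> `|q.1 - p.1| < e /\ `|q.2 - p.2| < e.
Proof.
move=> e0.
have [j je] : exists j, j.+1%:R^-1 < e / 2.
  by have [j _ /(_ j (leqnn j))] := near_infty_natSinv_lt (PosNum (divr_gt0 e0 (ltr0Sn _ 1))); exists j.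
have j0 : 0 < j.+1%:R^-1 :> R by rewrite invr_gt0 ltr0n.
set r := j.+1%:R^-1 in j0 je.
have ratx (x : R) : x - r < x + r.
  by rewrite ltrD2l gtrN.
have [q1 hq1] := rat_in_itvoo (ratx p.1).
have [q2 hq2] := rat_in_itvoo (ratx p.2).
move: hq1 hq2; rewrite !in_itv/= => /andP[? ?] /andP[? ?].
exists (pickle (q1, q2, j)); first by rewrite /box pickleK/= -/r !ltr_norml; split; apply/andP; split; lra.
rewrite /box pickleK => q /=; rewrite -/r !ltr_norml => -[/andP[? ?] /andP[? ?]].
by split; apply/andP; split; lra.
Qed.

Lemma box_open i : open (box i).
Proof.
rewrite /box; case: unpickle => [[[q1 q2] j]|]; last exact: open0.
rewrite (_ : [set _ | _] = fst @^-1` ball (ratr q1 : R) j.+1%:R^-1 `&`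
    snd @^-1` ball (ratr q2 : R) j.+1%:R^-1).
  apply: openI; apply: open_comp => [? _|]; [exact: cvg_fst| |exact: cvg_snd|];
    by apply: ball_open; rewrite invr_gt0 ltr0n.
by apply/seteqP; split=> p /=; rewrite -!ball_normE/= distrC (distrC p.2).
Qed.

Lemma measurable_box i : measurable (box i).
Proof.
rewrite /box; case: unpickle => [[[q1 q2] j]|]; last exact: measurable0.
rewrite (_ : [set _ | _] = ball (ratr q1 : R) j.+1%:R^-1 `*` ball (ratr q2 : R) j.+1%:R^-1).
  by apply: measurableX; exact: measurable_ball.
by apply/seteqP; split=> p /=; rewrite -!ball_normE/= distrC (distrC p.2).
Qed.

End boxes.
Arguments box : clear implicits.

(** * Closed limits of approximately monotone sets *)

Section closed_limit.
Context (R : realType) (mu : probability (R * R)%type R) (b : bool) (k : nat).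
Variables (c : R) (V : nat -> 'I_k -> set (R * R)).
Hypothesis V_square : forall m a, V m a `<=` unit_square R.
Hypothesis V_monotone : forall m a p q, V m a p -> V m a q ->
  p.1 + m.+1%:R^-1 <= q.1 -> ~~ ltr_dir_by b m.+1%:R^-1 q.2 p.2.
Hypothesis mV : forall m, measurable (\bigcup_a V m a).
Hypothesis cV : forall m, (c%:E <= mu (\bigcup_a V m a))%E.

(* The closed sets are the limits of the V m a along an ultrafilter on the
   indices m; a countable base makes their complements countable unions of
   boxes avoided by V m a for most m. *)
Lemma le_longest_tilde : (c%:E <= longest_tilde b k mu)%E.
Proof.
have [U [UU Uoo]] := @ultraFilterLemma nat \oo _.
have UF : ProperFilter U by exact: ultra_proper.
have FU : Filter U by exact: filter_filter.
(* A box is in [D a] when [V m a] misses it for [U]-most [m]; removing all these boxes leaves the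
   limit set [Z a]. *)
pose D a : set nat := [set i | U [set m | V m a `&` box R i = set0]].
pose Z a := ~` \bigcup_(i in D a) box R i.
have near_Z a p (e : R) : Z a p -> 0 < e ->
    U [set m | exists q, [/\ V m a q, `|q.1 - p.1| < e & `|q.2 - p.2| < e]].
  move=> Zp e0; have [i ip ie] := box_small p e0.
  (* A small box around a point of [Z a] is not in [D a], so by the ultrafilter dichotomy [V m a]
     meets it for [U]-most [m]. *)
  have [Ui|] := in_ultra_setVsetC [set m | V m a `&` box R i = set0] UU.
    by exfalso; apply: Zp; exists i.
  apply: filterS => m /eqP/set0P[q [Vq iq]].
  by exists q; have [? ?] := ie q iq.
have mZC a : measurable (\bigcup_(i in D a) box R i).
  by apply: bigcup_measurable => i _; exact: measurable_box.
have Z_closed a : closed (Z a).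
  by apply: open_closedC; apply: bigcup_open => i _; exact: box_open.
have Z_square a : Z a `<=` unit_square R.
  move=> p Zp.
  have sq (e : R) : 0 < e -> exists q, [/\ unit_square R q, `|q.1 - p.1| < e & `|q.2 - p.2| < e].
    move=> e0; have /filter_ex[m [q [Vq ? ?]]] := near_Z _ _ _ Zp e0.
    by exists q; split => //; exact: V_square Vq.
  rewrite /unit_square /= !in_itv/=; split; apply/andP; split; rewrite leNgt; apply/negP => h.
  - have [|q [[/= + _] + _]] := sq (- p.1); first by rewrite oppr_gt0.
    by rewrite in_itv/= ltr_norml; lra.
  - have [|q [[/= + _] + _]] := sq (p.1 - 1); first by rewrite subr_gt0.
    by rewrite in_itv/= ltr_norml; lra.
  - have [|q [[/= _ +] _]] := sq (- p.2); first by rewrite oppr_gt0.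
    by rewrite in_itv/= ltr_norml; lra.
  - have [|q [[/= _ +] _]] := sq (p.2 - 1); first by rewrite subr_gt0.
    by rewrite in_itv/= ltr_norml; lra.
have Z_monotone a : monotone_subset b (Z a).
  apply/monotone_subsetP => p q Zp Zq pq; apply/negP => qp.
  (* Moving both points by less than [e] costs less than [2 * e] of a gap of at least [4 * e]; what
     remains exceeds the margin $1/(m+1)<e$, which [V_monotone] forbids. *)
  pose e := Num.min (q.1 - p.1) `|q.2 - p.2| / 4.
  have e0 : 0 < e.
    rewrite divr_gt0// lt_min subr_gt0 pq normr_gt0 subr_eq0.
    by move: qp; rewrite /ltr_dir; case: (b) => /lt_eqF; rewrite 1?eq_sym => ->.
  have e1 : 4 * e <= q.1 - p.1 by rewrite /e mulrC divfK// ge_min lexx.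
  have e2 : 4 * e <= `|q.2 - p.2| by rewrite /e mulrC divfK// ge_min lexx orbT.
  have Ue : U [set m | m.+1%:R^-1 < e].
    by apply: Uoo; exact: (near_infty_natSinv_lt (PosNum e0)).
  have Upq := @filterI _ U FU _ _ (near_Z _ _ _ Zp e0) (near_Z _ _ _ Zq e0).
  have /filter_ex[m [me [[p' [Vp' + +]] [q' [Vq' + +]]]]] := @filterI _ U FU _ _ Ue Upq.
  rewrite !ltr_norml => /andP[? ?] /andP[? ?] /andP[? ?] /andP[? ?].
  rewrite /= in me; set r := m.+1%:R^-1 in me.
  have p'q' : p'.1 + r <= q'.1 by lra.
  have /negP := V_monotone Vp' Vq' p'q'; apply; rewrite -/r.
  move: qp; rewrite /ltr_dir /ltr_dir_by; case: (b) => qp.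
    by rewrite ler0_norm in e2; lra.
  by rewrite ger0_norm in e2; lra.
(* The complement of the union of the [Z a] is exhausted by sets involving only boxes of index below
   [j], so that each [G j] imposes finitely many conditions on [m]. *)
pose G j := \bigcap_a [set p | exists i, [/\ (i < j)%N, D a i & box R i p]].
have GE : \bigcup_j G j = ~` \bigcup_a Z a.
  apply/seteqP; split=> p.
    move=> [j _ Gj] [a _]; apply; have [i [_ Di ip]] := Gj a I.
    by exists i.
  move=> Zp; have /choice[i iP] : forall a, exists i, D a i /\ box R i p.
    move=> a; apply: contrapT => h; apply: Zp; exists a => // -[i Di ip].
    by apply: h; exists i.
  exists (\max_a i a).+1 => // a _; have [Di ip] := iP a.
  by exists (i a); split=> //; rewrite ltnS; exact: leq_bigmax.
have mG j : measurable (G j).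
  apply: fin_bigcap_measurable => // a _.
  rewrite (_ : [set _ | _] = \bigcup_(i in [set i | (i < j)%N] `&` D a) box R i).
    by apply: bigcup_measurable => i _; exact: measurable_box.
  by apply/seteqP; split=> p; [move=> [i [ij Di ip]]; exists i|move=> [i [ij Di] ip]; exists i].
have G_nd : nondecreasing_seq G.
  move=> j j' jj'; apply/subsetPset => p Gp a _; have [i [ij Di ip]] := Gp a I.
  by exists i; split => //; exact: leq_trans jj'.
have G_le j : (mu (G j) <= 1 - c%:E)%E.
  (* Finitely many [U]-large sets have a common element: a single [m] for which every [V m a] misses
     all the boxes used by [G j]. *)
  have : U [set m | forall ai : 'I_k * 'I_j, D ai.1 ai.2 -> V m ai.1 `&` box R ai.2 = set0].
    apply: filter_forall => -[a i] /=.
    have [Di|nDi] := pselect (D a i); first by apply: filterS Di.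
    by apply: filterS filterT => m _ /nDi.
  move=> /filter_ex[m mP].
  have VG : \bigcup_a V m a `<=` ~` G j.
    move=> p [a _ Vp] Gp; have [i [ij Di ip]] := Gp a I.
    have : (V m a `&` box R i) p by [].
    by rewrite (mP (a, Ordinal ij)).
  have : (mu (\bigcup_a V m a) <= mu (~` G j))%E.
    by apply: le_measure; rewrite ?inE//; exact: measurableC.
  rewrite probability_setC// => /(le_trans (cV m)).
  by rewrite -(@fineK _ (mu (G j))) ?fin_num_measure// -!EFinB !lee_fin; lra.
have A_ge : (c%:E <= mu (\bigcup_a Z a))%E.
  have mGU : measurable (\bigcup_j G j) by exact: bigcup_measurable.
  have : (mu (\bigcup_j G j) <= 1 - c%:E)%E.
    (* Continuity from below carries the bound on the [G j] over to their union. *)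
    have cvgG := @nondecreasing_cvg_mu _ _ _ mu _ mG mGU G_nd.
    rewrite -(cvg_lim _ cvgG)//.
    apply: lime_le; first by apply/cvg_ex; eexists; exact: cvgG.
    by apply: nearW => j; exact: G_le.
  rewrite -[in X in _ -> X](setCK (\bigcup_a Z a)) -GE probability_setC//.
  by rewrite -(@fineK _ (mu (\bigcup_j G j))) ?fin_num_measure// -!EFinB !lee_fin; lra.
apply: le_trans A_ge _; apply: ereal_sup_ubound; exists (\bigcup_a Z a) => //; split.
- by apply: closed_bigcup; [exact: finite_finset|move=> a _; exact: Z_closed].
- by move=> p [a _]; exact: Z_square.
- by exists Z.
Qed.

End closed_limit.

(** The plane carries the product sigma-algebra; an open set belongs to it as the countable union of
    the boxes that it contains. *)
Lemma open_measurable_plane (R : realType) (O : set (R * R)) :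
  open O -> measurable O.
Proof.
move=> Oo.
rewrite (_ : O = \bigcup_(i in [set i | box R i `<=` O]) box R i).
  by apply: bigcup_measurable => i _; exact: measurable_box.
apply/seteqP; split=> p; last by move=> [i]; exact.
move=> Op; have /nbhs_ballP[e /= e0 eO] : nbhs p O by exact: open_nbhs_nbhs.
have [i ip ie] := box_small p e0; exists i => // q /ie[q1 q2].
by apply: eO; split; rewrite -ball_normE/= distrC.
Qed.

Lemma closed_measurable_plane (R : realType) (A : set (R * R)) :
  closed A -> measurable A.
Proof.
move=> /closed_openC/open_measurable_plane/measurableC; rewrite setCK; exact.
Qed.

(** * Deviation bounds and almost sure convergence *)

Section deviation.
Context (R : realType) (mu : probability (R * R)%type R).
Hypothesis hmu : pre_permuton mu.
Context (b : bool) (k : nat).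

Let l := fine (longest_tilde b k mu).

Lemma longest_tilde_ge0 : (0 <= longest_tilde b k mu)%E.
Proof.
apply: ereal_sup_ubound; exists set0; last exact: measure0.
split; [exact: closed0|by []|].
exists (fun=> set0); last by rewrite bigcup0.
by move=> _; apply/monotone_subsetP.
Qed.

Lemma longest_tilde_fin_num : longest_tilde b k mu \is a fin_num.
Proof.
have le1 : (longest_tilde b k mu <= 1)%E.
  apply: ge_ereal_sup => _ [A [cA _ _] <-]; apply: probability_le1.
  exact: closed_measurable_plane.
by rewrite fin_numElt (lt_le_trans _ longest_tilde_ge0) ?(le_lt_trans le1) ?ltry.
Qed.

Definition grid_set N (S : {ffun 'I_k -> {set 'I_N.+1 * 'I_N.+1}}) : set (R * R) :=
  \bigcup_a @region R _ (S a).

Lemma measurable_grid_set N (S : {ffun 'I_k -> {set 'I_N.+1 * 'I_N.+1}}) :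
  measurable (grid_set S).
Proof.
apply: fin_bigcup_measurable; first exact: finite_finset.
by move=> a _; exact: measurable_region.
Qed.

(** Otherwise every mesh has an offending union of mass above [l + e], and [le_longest_tilde] would
    put the supremum itself at least that high. *)
Lemma grid_approximation (e : R) : 0 < e ->
  exists N, forall S : {ffun 'I_k -> {set 'I_N.+1 * 'I_N.+1}},
    (forall a, grid_monotone b (S a)) -> fine (mu (grid_set S)) <= l + e.
Proof.
move=> e0; apply: contrapT => noN.
have /choice[V VP] : forall m, exists V : 'I_k -> set (R * R),
    [/\ forall a, V a `<=` unit_square R,
        forall a p q, V a p -> V a q ->
          p.1 + m.+1%:R^-1 <= q.1 -> ~~ ltr_dir_by b m.+1%:R^-1 q.2 p.2,
        measurable (\bigcup_a V a) & ((l + e)%:E <= mu (\bigcup_a V a))%E].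
  (* The grid with parameter [m.+1] has a nonzero parameter and exactly the margin required at index
     [m]. *)
  move=> m; apply: contrapT => noV; apply: noN; exists m.+1 => S Sm.
  rewrite leNgt; apply/negP => lS; apply: noV.
  exists (fun a => @region R _ (S a)); split.
  - by move=> a p [].
  - by move=> a p q; exact: region_monotone.
  - exact: measurable_grid_set.
  - by rewrite -[leRHS]fineK ?lee_fin ?ltW// fin_num_measure//; exact: measurable_grid_set.
have : ((l + e)%:E <= longest_tilde b k mu)%E.
  by apply: (@le_longest_tilde _ _ _ _ _ V) => m; have [] := VP m.
by rewrite -(fineK longest_tilde_fin_num) lee_fin -/l; lra.
Qed.

(** The null event outside which [hits_le_longest] and [longest_grid] both apply. *)
Definition degenerate n : set (n.-tuple (R * R)) :=
  [set z | ties fst z \/ ties snd z \/ exists j, ~ unit_square R (tnth z j)].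
Arguments degenerate : clear implicits.

Lemma measurable_degenerate n : measurable (degenerate n).
Proof.
apply: measurableU; first exact: measurable_ties.
apply: measurableU; first exact: measurable_ties.
rewrite [X in measurable X](_ : _ = \bigcup_j [set z : n.-tuple (R * R) | ~ unit_square R (tnth z j)]).
  apply: fin_bigcup_measurable => // j _.
  apply: measurableC; rewrite -[X in measurable X]setTI.
  apply: (measurable_tnth j) => //.
  by apply: measurableX; exact: measurable_itv.
by apply/seteqP; split=> z [j]; [exists j|exists j].
Qed.

Lemma iid_law_degenerate n : iid_law mu n (degenerate n) = 0%E.
Proof.
have [mu1 mux muy] := hmu.
have msq : measurable (unit_square R) by apply: measurableX; exact: measurable_itv.
apply: measure_negligible; first exact: measurable_degenerate.
apply: negligibleU.
  by apply/negligibleP; [exact: measurable_ties|exact: iid_law_ties].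
apply: negligibleU.
  by apply/negligibleP; [exact: measurable_ties|exact: iid_law_ties].
have mC j : measurable [set z : n.-tuple (R * R) | (~` unit_square R) (tnth z j)].
  rewrite -[X in measurable X]setTI; apply: (measurable_tnth j) => //.
  exact: measurableC.
pose F j := [set z : n.-tuple (R * R) | (~` unit_square R) (tnth z j)].
have mF : measurable (\bigcup_j F j).
  by apply: fin_bigcup_measurable; [exact: finite_finset|move=> j _; exact: mC].
exists (\bigcup_j F j); split=> //.
- apply/eqP; rewrite -measure_le0.
  apply: le_trans.
    apply: (@measure_finite_union_le _ _ _ (iid_law mu n) _ xpredT F) => //.
    by move=> z [j _ Fj]; exists j.
  rewrite big1// => j _; rewrite /F; apply: eq_trans (iid_law_coord _ _ _) _.
    exact: measurableC.
  by rewrite probability_setC// mu1 subee.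
- by move=> z [j zj]; exists j.
Qed.

Definition deviates (e : R) n : set 'S_n :=
  [set s | e < `|n%:R^-1 * (longest b k s)%:R - l|].
Arguments deviates : clear implicits.

(** One [e] pays for approximating the supremum, by a closed set or by a grid, and the other for the
    fluctuation of the counts. *)
Lemma Sample_deviates (e : R) : 0 < e -> e <= 1 ->
  exists K : R, exists r : R, [/\ 0 <= r, r < 1 & forall n, (0 < n)%N ->
    (Sample mu (deviates (e *+ 2) n) <= (K * r ^+ n)%:E)%E].
Proof.
move=> e0 e1.
have [A [cA Asq kA] lA] : exists2 A, [/\ closed A, A `<=` unit_square R & k_monotone b k A] &
    l - e < fine (mu A).
  have [_ [A AP <-] lA] := ub_ereal_sup_adherent e0 longest_tilde_fin_num.
  exists A => //; rewrite -lte_fin EFinB /l fineK ?longest_tilde_fin_num//.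
  rewrite fineK// fin_num_measure//; have [cA _ _] := AP.
  exact: closed_measurable_plane.
have mA : measurable A.
  exact: closed_measurable_plane.
have [N NP] := grid_approximation e0.
pose FS : finType := {ffun 'I_k -> {set 'I_N.+1 * 'I_N.+1}}.
pose r := expR (- (e ^+ 2 / 8)).
exists #|{: option (option FS)}|%:R, r; split; first exact: expR_ge0.
  by rewrite expR_lt1 oppr_lt0 divr_gt0 ?exprn_gt0.
move=> n n0.
have n0' : 0 < n%:R :> R by rewrite ltr0n.
(* The bad events: a degenerate sample, too few points in [A], or too many in some union of cells.
   Their number does not depend on [n], hence the constant [K]. *)
pose F (o : option (option FS)) : set (n.-tuple (R * R)) :=
  match o with
  | None => degenerate n
  | Some None => [set z | #|hits A z|%:R <= n%:R * (fine (mu A) - e)]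
  | Some (Some C) => [set z | n%:R * (fine (mu (grid_set C)) + e) <= #|hits (grid_set C) z|%:R]
  end.
apply: le_trans.
  apply: (@measure_finite_union_le _ _ _ (iid_law mu n) _ xpredT F).
  - move=> [[S|]|]; [| |exact: measurable_degenerate].
      apply: (@measurable_hits _ _ n _ (fun H => n%:R * (fine (mu (grid_set S)) + e) <= #|H|%:R)).
      exact: measurable_grid_set.
    exact: (@measurable_hits _ _ n _ (fun H => #|H|%:R <= n%:R * (fine (mu A) - e))).
  - exact: measurable_Perm.
  - move=> z zdev.
    have [zdeg|zndeg] := pselect (degenerate n z); first by exists None.
    have xinj : injective (fun j => (tnth z j).1).
      move=> i j ij; apply: contrapT => nij; apply: zndeg; left.
      by exists i, j; split=> //; exact/eqP.
    have yinj : injective (fun j => (tnth z j).2).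
      move=> i j ij; apply: contrapT => nij; apply: zndeg; right; left.
      by exists i, j; split=> //; exact/eqP.
    have zsq j : unit_square R (tnth z j).
      by apply: contrapT => nzj; apply: zndeg; right; right; exists j.
    apply: contrapT => noF.
    have hitsA : n%:R * (fine (mu A) - e) < #|hits A z|%:R.
      by rewrite ltNge; apply/negP => h; apply: noF; exists (Some None).
    have longest_ge : #|hits A z|%:R <= (longest b k (Defs.Perm z))%:R :> R.
      by rewrite ler_nat; exact: hits_le_longest.
    have nl0 : 0 <= n%:R * (l + e *+ 2).
      by rewrite mulr_ge0// addr_ge0 ?mulrn_wge0 ?fine_ge0 ?longest_tilde_ge0 ?ltW.
    have longest_le : (longest b k (Defs.Perm z))%:R <= n%:R * (l + e *+ 2).
      (* [longest_grid] takes an integer bound, so the real bound is truncated; this is harmless for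
         integer counts. *)
      rewrite -truncn_ge_nat//.
      apply: (@longest_grid R N) => // S Sm.
      rewrite truncn_ge_nat//.
      have hitsS : #|hits (grid_set S) z|%:R < n%:R * (fine (mu (grid_set S)) + e).
        by rewrite ltNge; apply/negP => h; apply: noF; exists (Some (Some S)).
      apply: le_trans (ltW hitsS) _; rewrite ler_pM2l// mulr2n addrA lerD2r.
      exact: NP.
    move: zdev; rewrite /deviates/= ltNge => /negP; apply.
    rewrite mulrC ler_norml lerBlDr addrC; apply/andP; split; last first.
      by rewrite ler_pdivrMr// mulrC addrC.
    rewrite addrC lerBrDl ler_pdivlMr//; nra.
rewrite [leRHS](_ : _ = (\sum_(o : option (option FS)) (r ^+ n)%:E)%E); last first.
  by rewrite sumEFin sumr_const mulr_natl; congr (_ *+ _)%:E; exact: eq_card.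
apply: lee_sum => -[[S|]|] _.
- by apply: hits_upper_tail => //; exact: measurable_grid_set.
- exact: hits_lower_tail.
- by rewrite [leLHS]iid_law_degenerate lee_fin exprn_ge0 ?expR_ge0.
Qed.

(** For each tolerance $2/(j+1)$ the deviation probabilities are dominated by a geometric series.
    The first Borel-Cantelli lemma uses only the individual laws, and countably many tolerances are
    then intersected. *)
Lemma longest_cvg (d : measure_display) (W : measurableType d)
    (P : probability W R) (sigma : forall n : nat, W -> 'S_n) :
  (forall n : nat, (0 < n)%N -> has_law P (sigma n) (@Sample R mu n)) ->
  {ae P, forall w,
    (n%:R^-1 * (longest b k (sigma n w))%:R : R)%:E @[n --> \oo] -->
    longest_tilde b k mu}.
Proof.
move=> hsigma.
have ae_dev (j : nat) : {ae P, forall w, \forall n \near \oo,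
    ~ deviates (j.+1%:R^-1 *+ 2) n (sigma n w)}.
  have [||K [r [r0 r1 Kr]]] := @Sample_deviates j.+1%:R^-1.
  - by rewrite invr_gt0 ltr0n.
  - by rewrite invf_le1 ?ler1n ?ltr0n.
  (* The index is shifted by one because the law is prescribed only for positive sizes. *)
  pose F n := sigma n.+1 @^-1` deviates (j.+1%:R^-1 *+ 2) n.+1.
  have mF n : measurable (F n) by have [] := hsigma n.+1 isT (deviates (j.+1%:R^-1 *+ 2) n.+1).
  have PF n : (P (F n) <= (geometric (K * r) r n)%:E)%E.
    have [_ ->] := hsigma n.+1 isT (deviates (j.+1%:R^-1 *+ 2) n.+1).
    by rewrite /= -mulrA -exprS; exact: Kr.
  have Foo : (\sum_(n <oo) P (F n) < +oo)%E.
    apply: (@le_lt_trans _ _ (\sum_(n <oo) (geometric (K * r) r n)%:E)%E).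
      by apply: lee_nneseries => n *.
    have : eseries (fun n => (geometric (K * r) r n)%:E) @ \oo --> (K * r / (1 - r))%:E.
      rewrite (_ : eseries _ = EFin \o series (geometric (K * r) r)).
        apply: cvg_EFin; first exact: nearW.
        by apply: cvg_geometric_series; rewrite ger0_norm.
      by apply/funext => n; rewrite /eseries/= sumEFin.
    by move=> /cvg_lim ->//; rewrite ltry.
  exists (lim_sup_set F); split.
  - by apply: bigcap_measurable => // n _; apply: bigcup_measurable.
  - exact: lim_sup_set_cvg0.
  - move=> w wdev n _; apply: contrapT => noF; apply: wdev => /=.
    exists n.+1 => // -[//|m] /= nm wm; apply: noF; exists m => //.
apply: filterS (ae_foralln ae_dev) => w wdev.
rewrite -(fineK longest_tilde_fin_num).
apply: cvg_EFin; first exact: nearW.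
apply/cvgrPdist_lt => e e0 /=.
have [j je] : exists j, j.+1%:R^-1 < e / 2.
  by have [j _ /(_ j (leqnn j))] := near_infty_natSinv_lt (PosNum (divr_gt0 e0 (ltr0Sn _ 1))); exists j.
apply: filterS (wdev j) => n /negP; rewrite -leNgt distrC => /le_lt_trans; apply.
by set x := _^-1 in je *; lra.
Qed.

End deviation.

Theorem proposition2p2 (R : realType) (mu : probability (R * R)%type R)
    (hmu : pre_permuton mu)
    (d : measure_display) (W : measurableType d) (P : probability W R)
    (sigma : forall n : nat, W -> 'S_n)
    (hsigma : forall n : nat, (0 < n)%N -> has_law P (sigma n) (@Sample R mu n))
    (k : nat) (hk : (0 < k)%N) :
  {ae P, forall w,
    (n%:R^-1 * (LIS k (sigma n w))%:R : R)%:E @[n --> \oo] --> LIS_tilde k mu}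
  /\
  {ae P, forall w,
    (n%:R^-1 * (LDS k (sigma n w))%:R : R)%:E @[n --> \oo] --> LDS_tilde k mu}.
Proof.
(* At each boolean, [longest] and [longest_tilde] compute to the two notions of the statement. *)
by split; [exact: (longest_cvg hmu true k hsigma)
          |exact: (longest_cvg hmu false k hsigma)].
Qed.
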